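(* Let $\Omega\subseteq\mathbb{R}^{n+1}$ be nonempty, open and bounded, with points of $\mathbb{R}^{n+1}$ written $(x,t)\in\mathbb{R}^n\times\mathbb{R}$, and let $H=\Delta_x-\partial_t$ be the heat operator. For each $p\in(0,1)$ there exists a constant $c_p>0$, depending only on $n$, $\Omega$ and $p$, such that every smooth function $u:\Omega\to\mathbb{R}$ satisfying $Hu\geq 1$ on $\Omega$ satisfies $$\|u\|_{L^p(\Omega)}\geq c_p.$$
   Context: $\Delta_x$ denotes the Laplacian in the first $n$ variables. For $0<p<1$, $\|u\|_{L^p(\Omega)}=\left(\int_\Omega|u|^p\,dx\,dt\right)^{1/p}\in[0,\infty]$ is the $L^p$ quasi-norm. *)

(* Defs.v *)
From HB Require Import structures.
From mathcomp Require Import all_boot all_order all_algebra.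
From mathcomp Require Import all_classical all_reals all_analysis.

Set Implicit Arguments.
Unset Strict Implicit.
Unset Printing Implicit Defensive.
Import Order.TTheory GRing.Theory Num.Theory.
Import numFieldNormedType.Exports.
Local Open Scope classical_set_scope.
Local Open Scope ring_scope.

(* Row vectors carry the product sigma-algebra, i.e. the one generated by the
   coordinate maps; for 'rV[R]_n it is the Borel sigma-algebra.  This mirrors
   the library's instance on n.-tuple T. *)
Section measurable_rV.
Context {d} {T : sigmaRingType d} (n : nat).

Let coord : 'I_n -> 'rV[T]_n -> T := fun i v => v ord0 i.

Let rV_set0 : g_sigma_preimage coord set0.
Proof. exact: sigma_algebra0. Qed.

Let rV_setC A : g_sigma_preimage coord A -> g_sigma_preimage coord (~` A).
Proof. exact: sigma_algebraC. Qed.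

Let rV_bigcup (F : _^nat) : (forall i, g_sigma_preimage coord (F i)) ->
  g_sigma_preimage coord (\bigcup_i (F i)).
Proof. exact: sigma_algebra_bigcup. Qed.

HB.instance Definition _ := @isMeasurable.Build (measure_tuple_display d)
  'rV[T]_n (g_sigma_preimage coord) rV_set0 rV_setC rV_bigcup.

End measurable_rV.

Definition rV_rcons {T : Type} {n : nat} (z : 'rV[T]_n * T) : 'rV[T]_n.+1 :=
  \row_i oapp (z.1 ord0) z.2 (unlift ord_max i).

Lemma measurable_rV_coord d (T : sigmaRingType d) n (i : 'I_n) :
  measurable_fun [set: 'rV[T]_n] (fun v => v ord0 i).
Proof.
move=> _ Y mY; rewrite setTI; apply: sub_sigma_algebra => /=.
rewrite -bigcup_seq/=; exists i => /=; first by rewrite mem_index_enum.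
by exists Y => //; rewrite setTI.
Qed.

Lemma measurable_rV_rcons d (T : measurableType d) n :
  measurable_fun [set: 'rV[T]_n * T] (@rV_rcons T n).
Proof.
apply: (measurability (\big[setU/set0]_(i < n.+1)
  preimage_set_system setT (fun v : 'rV[T]_n.+1 => v ord0 i) measurable)) => //.
move=> _ [A + <-]; rewrite -bigcup_seq => -[/= i _ [B mB <-]].
rewrite !setTI; rewrite -[X in measurable X]setTI.
suff mi : measurable_fun [set: 'rV[T]_n * T]
    (fun z : 'rV[T]_n * T => rV_rcons z ord0 i) by exact: mi.
rewrite (_ : (fun z => _) = fun z : 'rV[T]_n * T =>
    oapp (z.1 ord0) z.2 (unlift ord_max i)); last first.
  by apply/funext => z; rewrite mxE.
case: (unlift ord_max i) => [j|] /=; last exact: measurable_snd.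
exact: (measurableT_comp (measurable_rV_coord j)).
Qed.

Section lebesgue_rV.
Context {R : realType}.

(* Lebesgue measure on R^n, by R^0 = {0} and R^n.+1 = R^n * R. *)
Fixpoint lebesgue_rV (n : nat) : set 'rV[R]_n -> \bar R :=
  if n is n'.+1 then
    pushforward (@lebesgue_rV n' \x (@lebesgue_measure R))%E (@rV_rcons R n')
  else \d_(0 : 'rV[R]_0).
Arguments lebesgue_rV : clear implicits.

Let lebesgue_rV_measure n :
  exists m : {measure set 'rV[R]_n -> \bar R}, lebesgue_rV n = m.
Proof.
elim: n => [|n [m /= ->]]; first by exists \d_(0 : 'rV[R]_0).
pose mu := (m \x (@lebesgue_measure R))%E : {measure set _ -> \bar R}.
exists (measure_function_pushforward__canonical__measure_function_Measure
  mu (@measurable_rV_rcons _ R n)).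
reflexivity.
Qed.

Variable n : nat.

Let lebesgue_rV0 : lebesgue_rV n set0 = 0%E :> \bar R.
Proof. by have [m ->] := lebesgue_rV_measure n; exact: measure0. Qed.

Let lebesgue_rV_ge0 A : (0 <= lebesgue_rV n A)%E.
Proof. by have [m ->] := lebesgue_rV_measure n; exact: measure_ge0. Qed.

Let lebesgue_rV_sigma_additive : semi_sigma_additive (lebesgue_rV n).
Proof.
by have [m ->] := lebesgue_rV_measure n; exact: measure_semi_sigma_additive.
Qed.

HB.instance Definition _ := isMeasure.Build _ _ _ (lebesgue_rV n)
  lebesgue_rV0 lebesgue_rV_ge0 lebesgue_rV_sigma_additive.

End lebesgue_rV.
Arguments lebesgue_rV {R} n _.

Section space_time.
Context {R : realType} {n : nat}.
Local Notation ST := ('rV[R]_n * R)%type.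
Implicit Types (Omega : set ST) (u : ST -> R).

(* Some i stands for the space coordinate x_i, None for the time coordinate. *)
Definition axis (k : option 'I_n) : ST :=
  if k is Some i then (delta_mx ord0 i, 0) else (0, 1).

Definition partial (k : option 'I_n) u : ST -> R := 'D_(axis k) u.

(* All the iterated partial derivatives exist and are continuous on Omega.
   For Omega open, this only depends on the values of u on Omega. *)
Definition smooth_on Omega u : Prop :=
  forall (s : seq (option 'I_n)) (z : ST), Omega z ->
    {for z, continuous (foldr partial u s)} /\
    forall k, derivable (foldr partial u s) z (axis k).

Definition laplacian_x u : ST -> R :=
  fun z => \sum_(i < n) partial (Some i) (partial (Some i) u) z.

Definition heat_op u : ST -> R := fun z => laplacian_x u z - partial None u z.

Definition Lp_quasinorm Omega (p : R) u : \bar R :=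
  ((\int[lebesgue_rV n \x @lebesgue_measure R]_(z in Omega) (`|u z| `^ p)%:E)
     `^ p^-1)%E.

End space_time.

(* Main.v *)
(* Fix a cylinder in [Omega].  Two cases give a lower bound for the integral of
   [|u| ^ p].  If [u] exceeds a small constant [h] at some point of the half-size
   cylinder, a weighted maximum of [u] produces a smaller cylinder whose centre
   has value [M] and on which [u <= A * M].  There [u > M / 8] on a set of
   measure bounded below: on a time slice [t = t1] before the centre, cover
   [u > M / 4] by small cells and compare [u], via the maximum principle, with a
   sum of heat kernels carried by these cells; since the heat kernel decays like
   [s ^ (- n / 2)], the cells must have total measure at least [c s ^ (n / 2)].
   If on the contrary [u <= h], comparison of [u - h] with an explicit barrier,
   using [H u >= 1], gives [u <= - h] on a still smaller cylinder. *)
From HB Require Import structures.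
Require Import Defs.
From mathcomp Require Import all_boot all_order all_algebra.
From mathcomp Require Import all_classical all_reals all_analysis.
From mathcomp Require Import measurable_realfun ring lra.

Import Order.TTheory GRing.Theory Num.Theory.
Import numFieldNormedType.Exports.
Local Open Scope classical_set_scope.
Local Open Scope ring_scope.

Set Implicit Arguments.
Unset Strict Implicit.
Unset Printing Implicit Defensive.

(** * One-variable restrictions and the heat operator *)

(** The difference quotients of [u] along [v] and of its restriction to the line are the same
    function of the increment. *)
Lemma is_derive_line (R : realType) (V : normedModType R) (u : V -> R)
    (z v : V) (h : R) :
  derivable u (h *: v + z) v ->
  is_derive h (1 : R) (fun k : R => u (k *: v + z)) ('D_v u (h *: v + z)).
Proof.
have E : (fun k : R => k^-1 *: (((fun k : R => u (k *: v + z)) \o shift h)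
      (k *: (1 : R)) - u (h *: v + z))) =
    (fun k => k^-1 *: ((u \o shift (h *: v + z)) (k *: v) - u (h *: v + z))).
  apply/funext => k /=; congr (_ *: (u _ - _)).
  by rewrite [k *: 1]mulr1 scalerDl addrA.
by move=> du; apply: DeriveDef; rewrite /derivable/derive ?E.
Qed.

Lemma near_line (R : realType) (V : normedModType R) (P : set V) (z v : V) :
  open P -> P z -> \forall h \near (0 : R), P (h *: v + z).
Proof.
move=> oP Pz.
have c : {for (0 : R), continuous (fun h : R => h *: v + z)}.
  apply: (@continuousD _ _ _ (fun h : R => h *: v)); last exact: cst_continuous.
  exact: scalel_continuous.
by apply: c; rewrite scale0r add0r; exact: open_nbhs_nbhs.
Qed.

Lemma near0P (R : realType) (P : set R) :
  (\forall h \near (0 : R), P h) <->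
  exists2 e : R, 0 < e & forall h, `|h| < e -> P h.
Proof.
split=> [[e /= e0 He]|[e e0 He]].
  by exists e => // h he; apply: He => /=; rewrite sub0r normrN.
by exists e => //= h /=; rewrite sub0r normrN; exact: He.
Qed.

(** If [D > 0], then [f' 0 = 0] makes [f'] positive just to the right of [0], and the mean value
    theorem gives [f c > f 0] for a small [c]. *)
Lemma second_derive_le0 (R : realType) (f f' : R -> R) (D : R) :
  (\forall h \near (0 : R), is_derive h (1 : R) f (f' h)) ->
  is_derive (0 : R) (1 : R) f' D -> (\forall h \near (0 : R), f h <= f 0) ->
  D <= 0.
Proof.
move=> df [df' D'] fmax; rewrite leNgt; apply/negP => Dgt0.
have [d d0 He] : exists2 d : R, 0 < d & forall h, `|h| < d ->
    is_derive h (1 : R) f (f' h) /\ f h <= f 0.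
  by apply/near0P; exact: filterI.
have f'0 : f' 0 = 0.
  have d1 : is_derive (0 : R) (1 : R) f 0.
    apply: (@derive1_at_max _ f (- d) d 0).
    - lra.
    - move=> t; rewrite in_itv /= => td.
      by have [|[]//] := He t; rewrite ltr_norml.
    - by rewrite in_itv /=; apply/andP; split; lra.
    - by move=> t; rewrite in_itv /= => td; have [] := He t; rewrite ?ltr_norml.
  have [|[_ <-] _] := He 0; first by rewrite normr0.
  by case: d1.
have : (fun h : R => h^-1 *: ((f' \o shift 0) (h *: (1 : R)) - f' 0)) @ 0^'+ --> D.
  by apply: cvg_dnbhs_at_right; rewrite -D'; exact: df'.
move=> /cvgr_gt /(_ _ Dgt0)[e /= e0 Hpos].
have f'pos h : 0 < h -> h < e -> 0 < f' h.
  move=> h0 he; have := Hpos h; rewrite /= sub0r normrN gtr0_norm// => /(_ he h0).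
  by rewrite f'0 subr0 addr0 [h *: 1]mulr1 pmulr_rgt0 ?invr_gt0.
pose c := Num.min d e / 2.
have m0 : 0 < Num.min d e by rewrite lt_min d0 e0.
have c0 : 0 < c by rewrite /c divr_gt0.
have cm : c < Num.min d e by rewrite /c ltr_pdivrMr// ltr_pMr// ltrDl.
have /andP[cd ce] : (c < d) && (c < e) by rewrite -lt_min.
have dfc x : 0 <= x -> x <= c -> is_derive x (1 : R) f (f' x).
  move=> x0 xc; have /He[//] : `|x| < d.
  by rewrite ger0_norm//; exact: le_lt_trans cd.
have cf : {within `[0, c], continuous f}.
  apply: derivable_within_continuous.
  move=> x; rewrite in_itv /= => /andP[x0 xc].
  by have [] := dfc x x0 xc.
have dfo x : x \in `]0, c[ -> is_derive x (1 : R) f (f' x).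
  by rewrite in_itv /= => /andP[x0 xc]; apply: dfc; exact: ltW.
have [x] := MVT c0 dfo cf.
rewrite in_itv /= => /andP[x0 xc]; rewrite subr0 => E.
have : 0 < f c - f 0 by rewrite E mulr_gt0// f'pos// (lt_trans xc).
have [|_] := He c; first by rewrite gtr0_norm.
lra.
Qed.

(** Left difference quotients at a maximum are nonnegative. The one-sided form serves on the top
    face of a cylinder, where only earlier times are available. *)
Lemma derive_ge0_at_left_max (R : realType) (f : R -> R) (d e : R) :
  0 < e -> is_derive (0 : R) (1 : R) f d ->
  (forall h, - e < h -> h < 0 -> f h <= f 0) -> 0 <= d.
Proof.
move=> e0 [df <-] fmax.
have cv : cvg ((fun h : R => h^-1 *: ((f \o shift 0) (h *: (1 : R)) - f 0)) @ 0^'-).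
  apply/cvg_ex; eexists; apply: cvg_dnbhs_at_left; exact: df.
rewrite /derive cvg_at_leftE//; apply: limr_ge => //.
exists e => //= h /=; rewrite sub0r normrN => he h0.
rewrite [h *: 1]mulr1 addr0; apply: mulr_le0.
  by rewrite invr_le0 ltW.
rewrite subr_le0; apply: fmax => //.
by rewrite ltrNl; apply: le_lt_trans he; rewrite -normrN ler_norm.
Qed.

Section heat_at.
Context {R : realType} {n : nat}.
Local Notation ST := ('rV[R]_n * R)%type.
Implicit Types (u g : ST -> R) (z : ST).

(* Pointwise value of the heat operator, read off from one-variable
   restrictions; unlike [heat_op] it is additive without computing with
   iterated directional derivatives on the whole space. *)
Definition heat_at u z (L : R) := exists (d1 : 'I_n -> R -> R) (d2 : 'I_n -> R)
    (dt : R),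
  [/\ forall i, \forall h \near (0 : R), is_derive h (1 : R)
        (fun k : R => u (k *: axis (Some i) + z)) (d1 i h),
      forall i, is_derive (0 : R) (1 : R) (d1 i) (d2 i),
      is_derive (0 : R) (1 : R) (fun k : R => u (k *: axis None + z)) dt &
      \sum_i d2 i - dt = L].

Lemma heat_at_smooth (Omega : set ST) u z : open Omega -> smooth_on Omega u ->
  Omega z -> heat_at u z (heat_op u z).
Proof.
move=> oO su Oz.
exists (fun i h => partial (Some i) u (h *: axis (Some i) + z)),
  (fun i => partial (Some i) (partial (Some i) u) z), (partial None u z).
split; last by [].
- move=> i; apply: filterS (near_line (axis (Some i)) oO Oz) => h Oh.
  by apply: is_derive_line; exact: (su [::] _ Oh).2.
- move=> i; have := @is_derive_line _ _ (partial (Some i) u) z (axis (Some i)) 0.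
  by rewrite scale0r add0r; apply; exact: (su [:: Some i] _ Oz).2.
- have := @is_derive_line _ _ u z (axis None) 0.
  by rewrite scale0r add0r; apply; exact: (su [::] _ Oz).2.
Qed.

Lemma heat_atD u g z L M : heat_at u z L -> heat_at g z M ->
  heat_at (fun w => u w + g w) z (L + M).
Proof.
move=> [a1 [a2 [a [A1 A2 A <-]]]] [b1 [b2 [b [B1 B2 B <-]]]].
exists (fun i => a1 i + b1 i), (fun i => a2 i + b2 i), (a + b); split.
- by move=> i; near=> h; apply: is_deriveD; near: h; [exact: A1|exact: B1].
- by move=> i; exact: is_deriveD.
- exact: is_deriveD.
- by rewrite big_split /=; ring.
Unshelve. all: by end_near. Qed.

Lemma heat_atZ u z L c : heat_at u z L -> heat_at (fun w => c * u w) z (c * L).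
Proof.
move=> [a1 [a2 [a [A1 A2 A <-]]]].
exists (fun i => c \*: a1 i), (fun i => c * a2 i), (c * a); split.
- by move=> i; near=> h; apply: is_deriveZ; near: h; exact: A1.
- by move=> i; exact: is_deriveZ.
- exact: is_deriveZ.
- by rewrite -mulr_sumr; ring.
Unshelve. all: by end_near. Qed.

Lemma heat_at_cst c z : heat_at (fun=> c) z 0.
Proof.
exists (fun _ _ => 0), (fun=> 0), 0; split.
- by move=> i; near=> h; exact: is_derive_cst.
- by move=> i; exact: is_derive_cst.
- exact: is_derive_cst.
- by rewrite big1 ?subr0.
Unshelve. all: by end_near. Qed.

Lemma heat_at_sum (I : Type) (s : seq I) (P : pred I) (f : I -> ST -> R)
    (L : I -> R) z : (forall i, P i -> heat_at (f i) z (L i)) ->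
  heat_at (fun w => \sum_(i <- s | P i) f i w) z (\sum_(i <- s | P i) L i).
Proof.
move=> fL; elim: s => [|i s IH].
  under eq_fun do rewrite big_nil.
  by rewrite big_nil; exact: heat_at_cst.
under eq_fun do rewrite big_cons.
rewrite big_cons; case: ifPn => // Pi.
by apply: heat_atD => //; exact: fL.
Qed.

End heat_at.

(** * Maximum principle and explicit caloric functions *)

Section cylinders.
Context {R : realType} {n : nat}.
Local Notation ST := ('rV[R]_n * R)%type.
Implicit Types (u g w : ST -> R) (z : ST) (x y : 'rV[R]_n).

(** With cubes as spatial sections, a cylinder is a product of segments, hence compact, and closed
    balls of space-time are cylinders. *)
Definition cylinder x (r t1 t0 : R) : set ST :=
  [set z : ST | (forall i, `|z.1 ord0 i - x ord0 i| <= r) /\ t1 <= z.2 <= t0].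

Definition sqdist y z : R := \sum_i (z.1 ord0 i - y ord0 i) ^+ 2.

Lemma axis_lineE (h : R) z i j :
  (h *: axis (Some i) + z).1 ord0 j = h * (j == i)%:R + z.1 ord0 j.
Proof. by rewrite /axis /= !mxE eqxx. Qed.

Lemma axis_line2 (h : R) z i : (h *: axis (Some i) + z).2 = z.2.
Proof. by rewrite /axis /= [X in X + _]mulr0 add0r. Qed.

Lemma axis_time (h : R) z : h *: axis None + z = (z.1, h + z.2).
Proof.
rewrite /axis [LHS]surjective_pairing /=; congr pair.
  by rewrite scaler0 add0r.
by rewrite [X in X + _]mulr1.
Qed.

Lemma sqdist_axis y (h : R) z i : sqdist y (h *: axis (Some i) + z) =
  sqdist y z + 2 * (z.1 ord0 i - y ord0 i) * h + h ^+ 2.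
Proof.
rewrite /sqdist (bigD1 i)// [in RHS](bigD1 i)//=.
rewrite -/(axis (Some i)) axis_lineE eqxx mulr1.
under eq_bigr => j ji do rewrite axis_lineE (negPf ji) mulr0 add0r.
ring.
Qed.

Lemma cylinderE x r t1 t0 : cylinder x r t1 t0 =
  [set v : 'rV[R]_n | forall i, v ord0 i \in `[x ord0 i - r, x ord0 i + r]]
    `*` `[t1, t0]%classic.
Proof.
apply/seteqP; split=> [z [zx zt]|z [zx zt]]; split=> //=.
- by move=> i; rewrite in_itv /= -ler_distl.
- by move=> i; have := zx i; rewrite /= in_itv /= -ler_distl.
Qed.

Lemma compact_cylinder x r t1 t0 : compact (cylinder x r t1 t0).
Proof.
rewrite cylinderE; apply: compact_setX; last exact: segment_compact.
apply: (@rV_compact _ _ (fun i => `[x ord0 i - r, x ord0 i + r]%classic)).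
by move=> i; exact: segment_compact.
Qed.

(** A positive maximum over the compact cylinder would be attained off the bottom and the sides.
    There the second space derivatives are nonpositive and the time derivative is nonnegative, even
    on the top face, which contradicts [0 < L]. *)
Lemma maximum_principle x (r t1 t0 : R) w (L : ST -> R) :
  {within cylinder x r t1 t0, continuous w} ->
  (forall z, cylinder x r t1 t0 z -> heat_at w z (L z)) ->
  (forall z, cylinder x r t1 t0 z -> 0 < L z) ->
  (forall z, cylinder x r t1 t0 z -> z.2 = t1 -> w z <= 0) ->
  (forall z i, cylinder x r t1 t0 z -> `|z.1 ord0 i - x ord0 i| = r ->
    w z <= 0) ->
  forall z, cylinder x r t1 t0 z -> w z <= 0.
Proof.
move=> cw Lw L0 bot lat z Kz.
have [c Kc cmax] := compact_EVT_max (ex_intro _ z Kz)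
  (@compact_cylinder x r t1 t0) cw.
rewrite inE in Kc; have {}cmax q : cylinder x r t1 t0 q -> w q <= w c.
  by move=> Kq; apply: cmax; rewrite inE.
apply: le_trans (cmax _ Kz) _; rewrite leNgt; apply/negP => wc0.
have [cx /andP[ct1 ct0]] := Kc.
have {ct1}ct1 : t1 < c.2.
  rewrite lt_neqAle ct1 andbT; apply/eqP => /esym/(bot _ Kc).
  by rewrite leNgt wc0.
have {}cx i : `|c.1 ord0 i - x ord0 i| < r.
  rewrite lt_neqAle cx andbT; apply/eqP => /(lat _ _ Kc).
  by rewrite leNgt wc0.
have [d1 [d2 [dt [D1 D2 Dt DL]]]] := Lw _ Kc.
have := L0 _ Kc; rewrite -DL; apply/negP; rewrite -leNgt subr_le0.
apply: (@le_trans _ _ 0); last first.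
  apply: (derive_ge0_at_left_max _ Dt); first by rewrite -subr_gt0 in ct1; exact: ct1.
  move=> h; rewrite !axis_time add0r => hct h0.
  rewrite -surjective_pairing; apply: cmax; split=> /= [i|]; first exact/ltW.
  by apply/andP; split; lra.
apply: sumr_le0 => i _; apply: second_derive_le0 (D1 i) (D2 i) _.
apply/near0P; exists (r - `|c.1 ord0 i - x ord0 i|); first by rewrite subr_gt0.
move=> h hr; rewrite scale0r add0r; apply: cmax; split=> [j|]; last first.
  by rewrite axis_line2 ltW.
rewrite axis_lineE -addrA; have [->|_] := eqVneq; last first.
  by rewrite mulr0 add0r ltW.
by rewrite mulr1 (le_trans (ler_normD _ _))//; lra.
Qed.

Lemma is_derive_quad (a b c h : R) :
  is_derive h (1 : R) (fun k => a + b * k + c * k ^+ 2) (b + c * (2 * h)).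
Proof.
pose p : {poly R} := a%:P + b *: 'X + c *: 'X^2.
have -> : (fun k => a + b * k + c * k ^+ 2) = horner p.
  by apply/funext => k; rewrite /p !hornerE.
have -> : b + c * (2 * h) = (deriv p).[h]; last exact: is_derive_poly.
rewrite /p !derivD !derivZ derivC derivX derivXn !hornerE /=; ring.
Qed.

Lemma is_derive_affine (a b h : R) :
  is_derive h (1 : R) (fun k => a + b * k) b.
Proof.
have := is_derive_quad a b 0 h; rewrite mul0r addr0.
by under eq_fun do rewrite mul0r addr0.
Qed.

Lemma heat_at_sqdist y z : heat_at (sqdist y) z (2 * n%:R).
Proof.
exists (fun i h => 2 * (z.1 ord0 i - y ord0 i) + 2 * h), (fun=> 2), 0.
split.
- move=> i; near=> h.
  rewrite (_ : (fun k => _) = fun k => sqdist y z +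
      2 * (z.1 ord0 i - y ord0 i) * k + 1 * k ^+ 2).
    by have := is_derive_quad (sqdist y z) (2 * (z.1 ord0 i - y ord0 i)) 1 h;
      rewrite mul1r.
  by apply/funext => k; rewrite sqdist_axis mul1r.
- by move=> i; exact: is_derive_affine.
- rewrite (_ : (fun k => _) = cst (sqdist y z)); first exact: is_derive_cst.
  by apply/funext => k; rewrite axis_time.
- by rewrite subr0 sumr_const card_ord mulr_natr.
Unshelve. all: by end_near. Qed.

Lemma heat_at_time c z : heat_at (fun w : ST => w.2 - c) z (- 1).
Proof.
exists (fun _ _ => 0), (fun=> 0), 1; split.
- move=> i; near=> h.
  rewrite (_ : (fun k => _) = cst (z.2 - c)); first exact: is_derive_cst.
  by apply/funext => k; rewrite axis_line2.
- by move=> i; exact: is_derive_cst.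
- rewrite (_ : (fun k => _) = fun k => (z.2 - c) + 1 * k).
    exact: is_derive_affine.
  by apply/funext => k; rewrite axis_time /=; ring.
- by rewrite big1 ?sub0r.
Unshelve. all: by end_near. Qed.

(** This function vanishes at time [c] and where [sqdist y = r]. It is the barrier of
    [negative_below], with [r] there the square of a radius. *)
Lemma heat_at_barrier y c r z :
  heat_at (fun w : ST => (w.2 - c) * (r - sqdist y w)) z
    (- (2 * n%:R * (z.2 - c) + (r - sqdist y z))).
Proof.
set T := z.2 - c.
exists (fun i h => - T * (2 * (z.1 ord0 i - y ord0 i)) + (- 2 * T) * h),
  (fun=> - 2 * T), (r - sqdist y z); split.
- move=> i; near=> h.
  rewrite (_ : (fun k => _) = fun k => T * (r - sqdist y z) +
      (- T * (2 * (z.1 ord0 i - y ord0 i))) * k + (- T) * k ^+ 2).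
    have := is_derive_quad (T * (r - sqdist y z))
      (- T * (2 * (z.1 ord0 i - y ord0 i))) (- T) h.
    by rewrite (_ : - T * (2 * h) = - 2 * T * h)//; ring.
  by apply/funext => k; rewrite sqdist_axis axis_line2 -/T; ring.
- by move=> i; exact: is_derive_affine.
- rewrite (_ : (fun k => _) =
      fun k => T * (r - sqdist y z) + (r - sqdist y z) * k).
    exact: is_derive_affine.
  by apply/funext => k; rewrite axis_time /sqdist /= /T; ring.
- by rewrite sumr_const card_ord -mulr_natr; ring.
Unshelve. all: by end_near. Qed.

(* The Gaussian [s^(-n/2) exp (-|x - y|^2 / (4 s))] where [s = t - c],
   with the power written as an exponential. *)
Definition gaussian y (c : R) z : R :=
  expR (- (n%:R / 2) * ln (z.2 - c) - (4 * (z.2 - c))^-1 * sqdist y z).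

Lemma heat_at_gaussian y c z : c < z.2 -> heat_at (gaussian y c) z 0.
Proof.
move=> cz; set s := z.2 - c; have s0 : 0 < s by rewrite subr_gt0.
have sn : s != 0 by rewrite gt_eqF.
pose b i := z.1 ord0 i - y ord0 i.
pose q := (4 * s)^-1.
pose a := - (n%:R / 2) * ln s - q * sqdist y z.
(* Along the [i]-th space axis through [z], the exponent is the quadratic polynomial [P i]. *)
pose P i h := a + (- q * (2 * b i)) * h + (- q) * h ^+ 2.
pose P' i h := (- q * (2 * b i)) + (- q * 2) * h.
have dP i h : is_derive h (1 : R) (P i) (P' i h).
  have := is_derive_quad a (- q * (2 * b i)) (- q) h.
  by rewrite (_ : - q * (2 * h) = - q * 2 * h)//; ring.
have deP i h : is_derive h (1 : R) (expR \o P i) (expR (P i h) * P' i h).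
  exact: is_derive1_comp.
have dP' i h : is_derive h (1 : R) (P' i) (- q * 2) by exact: is_derive_affine.
exists (fun i h => expR (P i h) * P' i h),
  (fun i => expR a * ((- q * (2 * b i)) ^+ 2 - q * 2)),
  (expR a * (- (n%:R / 2) * s^-1 + (4 * s ^+ 2)^-1 * sqdist y z)); split.
- move=> i; near=> h.
  rewrite (_ : (fun k => _) = expR \o P i)//.
  apply/funext => k /=; rewrite /gaussian sqdist_axis axis_line2 -/s -/q /P /a /b.
  by congr expR; ring.
- move=> i.
  have := @is_deriveM _ _ (expR \o P i) (P' i) 0 1 _ _ (deP i 0) (dP' i 0).
  move=> /is_derive_eq; apply.
  rewrite /GRing.scale /= /P /P' !mulr0 expr0n /= mulr0 !addr0; ring.
- have ds : is_derive (0 : R) (1 : R) (fun k => s + 1 * k) 1.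
    exact: is_derive_affine.
  have s00 : s + 1 * 0 != 0 by rewrite mulr0 addr0.
  have dl : is_derive (0 : R) (1 : R) (@ln R \o (fun k => s + 1 * k)) (s^-1 * 1).
    apply: is_derive1_comp.
    by rewrite mulr0 addr0; exact: is_derive1_ln.
  have dv := @is_deriveV _ (fun k => s + 1 * k) 0 _ _ s00 ds.
  (* [Q] is the exponent along the time axis. *)
  pose Q := (- (n%:R / 2)) \*: (@ln R \o (fun k => s + 1 * k))
    - (4^-1 * sqdist y z) \*: (fun k => (s + 1 * k)^-1).
  have dQ : is_derive (0 : R) (1 : R) Q (- (n%:R / 2) * s^-1 +
      (4 * s ^+ 2)^-1 * sqdist y z).
    have := is_deriveB (is_deriveZ (- (n%:R / 2)) dl)
      (is_deriveZ (4^-1 * sqdist y z) dv).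
    move=> /is_derive_eq; apply.
    rewrite /GRing.scale /= mulr0 addr0; by field.
  have sc (u v : R) : u *: v = u * v by [].
  have Q0 : Q 0 = a.
    by rewrite /Q /= !fctE /= !sc mulr0 addr0 /a /q invfM; ring.
  have := @is_derive1_comp _ expR Q 0 _ _ (is_derive_expR _) dQ.
  rewrite Q0; rewrite (_ : expR \o Q = fun k => gaussian y c (k *: axis None + z))//.
  apply/funext => k /=; rewrite /gaussian axis_time /= /Q !fctE /= !sc.
  rewrite (_ : k + z.2 - c = s + 1 * k); last by rewrite /s; ring.
  by rewrite invfM /sqdist /=; congr expR; ring.
(* Since [4 q ^ 2 = 1 / (4 s ^ 2)] and [2 n q = n / (2 s)], the space and time terms cancel. *)
- rewrite -mulr_sumr -mulrBr big_split /= sumr_const card_ord.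
  rewrite (eq_bigr (fun i => (4 * q ^+ 2) * b i ^+ 2)); last by move=> i _; ring.
  rewrite -mulr_sumr -/(sqdist y z) -mulr_natr /q.
  apply/eqP; rewrite mulf_eq0; apply/orP; right; apply/eqP; by field.
Unshelve. all: by end_near. Qed.

End cylinders.

(** * Lebesgue measure on row vectors *)

Section measure_rV.
Context {R : realType}.

(** Half-open, so that the cells of a grid are disjoint and leave no gap. *)
Definition cell {n} (lo : 'rV[R]_n) (a : R) : set 'rV[R]_n :=
  [set v | forall i, lo ord0 i <= v ord0 i < lo ord0 i + a].

Lemma measurable_coord_itv n (i : 'I_n) (J : interval R) :
  measurable [set v : 'rV[R]_n | v ord0 i \in J].
Proof.
have := @measurable_rV_coord _ R n i measurableT _ (measurable_itv J).
by rewrite setTI.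
Qed.

Lemma measurable_coords n (J : 'I_n -> interval R) :
  measurable [set v : 'rV[R]_n | forall i, v ord0 i \in J i].
Proof.
rewrite (_ : [set _ | _] =
    \bigcap_(i in [set: 'I_n]) [set v : 'rV[R]_n | v ord0 i \in J i]).
  apply: fin_bigcap_measurable; first exact: finite_finset.
  by move=> i _; exact: measurable_coord_itv.
by apply/seteqP; split=> [v vJ i _|v vJ i]; [exact: vJ|exact: (vJ i I)].
Qed.

Lemma cellE n (lo : 'rV[R]_n) a : cell lo a =
  [set v | forall i, v ord0 i \in `[lo ord0 i, (lo ord0 i + a)[ ].
Proof.
by apply/seteqP; split=> v vJ i; have := vJ i; rewrite in_itv.
Qed.

Lemma measurable_cell n (lo : 'rV[R]_n) a : measurable (cell lo a).
Proof. by rewrite cellE; exact: measurable_coords. Qed.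

(** Induction along the recursive definition of the measure: the preimage of a cell under [rV_rcons]
    is a cell of one dimension less times an interval. *)
Lemma lebesgue_rV_cell n (lo : 'rV[R]_n) a : 0 <= a ->
  lebesgue_rV n (cell lo a) = (a ^+ n)%:E.
Proof.
move=> a0; elim: n lo => [|n IH] lo.
  by rewrite /= expr0 diracE mem_set// => -[].
pose lo' : 'rV[R]_n := \row_i lo ord0 (lift ord_max i).
pose J := `[lo ord0 ord_max, (lo ord0 ord_max + a)[%classic.
have -> : lebesgue_rV n.+1 (cell lo a) =
    (lebesgue_rV n \x lebesgue_measure)%E (cell lo' a `*` J).
  rewrite /= /pushforward; congr (product_measure1 _ _ _).
  apply/seteqP; split=> -[x t] /=.
    move=> H; split=> [i|].
      by have := H (lift ord_max i); rewrite !mxE liftK.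
    by have := H ord_max; rewrite !mxE unlift_none /J /= in_itv.
  move=> [Hx Ht] i; rewrite !mxE; case: unliftP => [j ->|->] /=.
    by have := Hx j; rewrite mxE.
  by move: Ht; rewrite /J /= in_itv.
transitivity (lebesgue_rV n (cell lo' a) * @lebesgue_measure R J)%E.
  have mJ : measurable J by exact: measurable_itv.
  have := @product_measure1E _ _ _ _ R (lebesgue_rV n) (@lebesgue_measure R) _ _ (measurable_cell lo' a) mJ; exact.
rewrite IH lebesgue_measure_itv /= lte_fin ltrDl exprSr EFinM.
case: ltP => [_|an]; first by rewrite -EFinD addrAC subrr add0r.
by have -> : a = 0; [apply/eqP; rewrite eq_le an a0|].
Qed.

Lemma lebesgue_rV_sigma_finite n : sigma_finite setT (@lebesgue_rV R n).
Proof.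
exists (fun k => cell (const_mx (- k%:R)) (2 * k%:R)).
  apply/esym/seteqP; split=> // v _.
  pose M := \sum_i `|v ord0 i|.
  exists (Num.truncn M).+1 => //= i; rewrite mxE.
  have vM : `|v ord0 i| < (Num.truncn M).+1%:R.
    apply: le_lt_trans (truncnS_gt _).
    by rewrite /M (bigD1 i)//= lerDl sumr_ge0.
  by move: vM; rewrite ltr_norml => /andP[]; lra.
move=> k; split; first exact: measurable_cell.
by rewrite lebesgue_rV_cell ?ltry// mulr_ge0.
Qed.

HB.instance Definition _ n := Measure_isSigmaFinite.Build _ _ _
  (@lebesgue_rV R n) (@lebesgue_rV_sigma_finite n).

(** An open set is a countable union of boxes with rational centre and radius [1 / (k + 1)], and
    boxes are measurable for the product sigma-algebra. *)
Lemma measurable_open n (A : set ('rV[R]_n * R)) : open A -> measurable A.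
Proof.
move=> oA.
pose B (q : 'rV[rat]_n * rat * nat) : set ('rV[R]_n * R) :=
  [set v : 'rV[R]_n | forall i, v ord0 i \in
     `]ratr (q.1.1 ord0 i) - q.2.+1%:R^-1, ratr (q.1.1 ord0 i) + q.2.+1%:R^-1[ ]
  `*` `]ratr q.1.2 - q.2.+1%:R^-1, ratr q.1.2 + q.2.+1%:R^-1[%classic.
have -> : A = \bigcup_(q in [set q | B q `<=` A]) B q.
  apply/seteqP; split=> [z Az|z [q /= BA]]; last exact: BA.
  have [e /= e0 eA] := (nbhs_ballP _ _).1 (open_nbhs_nbhs (conj oA Az)).
  (* The point [z] and any point of the box both lie within [1 / (k + 1)] of the centre, hence the
     factor [2]. *)
  pose k := Num.truncn (2 / e).
  have ke : 2 * k.+1%:R^-1 < e.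
    have := truncnS_gt (2 / e); rewrite -/k ltr_pdivrMr// => H.
    by rewrite ltr_pdivrMr// mulrC.
  set d := k.+1%:R^-1 in ke; have d0 : 0 < d by rewrite invr_gt0.
  have dd (x : R) : {q : rat | x - d < ratr q < x + d}.
    apply: cid; have [|q] := @rat_in_itvoo _ (x - d) (x + d); first by lra.
    by exists q.
  have near_d (x q y : R) : x - d < q < x + d -> q - d < y < q + d ->
      `|x - y| < e.
    by move=> /andP[? ?] /andP[? ?]; rewrite ltr_norml; apply/andP; split; lra.
  exists (\row_i sval (dd (z.1 ord0 i)), sval (dd z.2), k) => /=.
    move=> v [/= v1 v2]; apply: eA; split=> /=.
      split=> // i j; rewrite [i]ord1 /ball /=.
      have := v1 j; rewrite mxE in_itv /=.
      by move: (svalP (dd (z.1 ord0 j))); exact: near_d.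
    rewrite in_itv /= in v2.
    by move: (svalP (dd z.2)) v2; exact: near_d.
  split=> /= [i|]; rewrite ?mxE in_itv /= -/d.
    by have := svalP (dd (z.1 ord0 i)); lra.
  by have := svalP (dd z.2); lra.
rewrite bigcup_mkcond.
apply: countable_bigcupT_measurable; first exact: countableP.
move=> q; case: ifPn => // _.
by apply: measurableX; [exact: measurable_coords|exact: measurable_itv].
Qed.

(** Tonelli with time as the outer variable: [\x] is first replaced by [\x^], which integrates over
    time slices and agrees with it by uniqueness of the product measure. *)
Lemma measure_slices_ge n (A : set ('rV[R]_n * R)) (s1 s2 : R) (c : R) :
  measurable A -> s1 <= s2 -> 0 <= c ->
  (forall t, s1 <= t <= s2 -> (c%:E <= lebesgue_rV n (ysection A t))%E) ->
  ((c * (s2 - s1))%:E <= (lebesgue_rV n \x @lebesgue_measure R) A)%E.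
Proof.
move=> mA s12 c0 cA.
have -> : (lebesgue_rV n \x @lebesgue_measure R)%E A =
    (lebesgue_rV n \x^ @lebesgue_measure R)%E A.
  apply: product_measure_unique => // B C mB mC.
  exact: (@product_measure2E _ _ _ _ R (lebesgue_rV n) (@lebesgue_measure R)
    B C mB mC).
have mf := @measurable_fun_ysection _ _ _ _ R (lebesgue_rV n) A mA.
have ms : measurable `[s1, s2]%classic by exact: measurable_itv.
apply: (@le_trans _ _ (\int[@lebesgue_measure R]_(t in `[s1, s2])
    lebesgue_rV n (ysection A t))%E); last first.
  apply: ge0_subset_integral => //.
have -> : (c * (s2 - s1))%:E =
    (\int[@lebesgue_measure R]_(t in `[s1, s2]) cst c%:E t)%E.
  rewrite integral_cst//= lebesgue_measure_itv /= lte_fin.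
  case: ltP => [_|s21]; first by rewrite -EFinD -EFinM.
  have -> : s1 = s2 by apply/eqP; rewrite eq_le s12 s21.
  by rewrite subrr mule0 mulr0.
apply: ge0_le_integral => //.
exact: measurable_funS mf.
Qed.

(** Markov's inequality. Measurability of [u] relative to [Omega] holds because its superlevel sets
    inside [Omega] are open. *)
Lemma le_Lp_integral n (Omega : set ('rV[R]_n * R)) (u : 'rV[R]_n * R -> R)
    (p M : R) (E : set ('rV[R]_n * R)) :
  open Omega -> (forall z, Omega z -> {for z, continuous u}) ->
  measurable E -> E `<=` Omega -> 0 < p -> 0 <= M ->
  (forall z, E z -> M <= `|u z|) ->
  ((M `^ p)%:E * (lebesgue_rV n \x @lebesgue_measure R) E <=
   \int[lebesgue_rV n \x @lebesgue_measure R]_(z in Omega)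
     (`|u z| `^ p)%:E)%E.
Proof.
move=> oO cu mE EO p0 M0 uM.
have mO := measurable_open oO.
have mu : measurable_fun Omega u.
  apply: (measurability _ (RGenOInfty.measurableE R)) => //.
  move=> _ [_ [y ->] <-]; apply: measurable_open.
  rewrite openE => z [Oz]; rewrite /= in_itv /= andbT => yz.
  apply: filterI; first exact: open_nbhs_nbhs.
  have /cvgr_gt/(_ _ yz) := cu z Oz; apply: filterS => w yw.
  by rewrite /= in_itv /= andbT.
have mup : measurable_fun Omega (fun z => (`|u z| `^ p)%:E).
  apply/measurable_EFinP; apply: (measurableT_comp (measurable_powR p)).
  exact: measurableT_comp.
apply: (@le_trans _ _ (\int[lebesgue_rV n \x @lebesgue_measure R]_(z in E)
     (`|u z| `^ p)%:E)%E); last first.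
  apply: ge0_subset_integral => //.
rewrite -integral_cst//; apply: ge0_le_integral => //.
- by move=> z _; rewrite lee_fin powR_ge0.
- exact: measurable_funS mup.
- by move=> z Ez; rewrite lee_fin; apply: ge0_ler_powR => //;
    rewrite ?nnegrE ?(ltW p0)//; exact: uM.
Qed.

End measure_rV.

(** * Measure of superlevel sets *)

Section density.
Context {R : realType} {n : nat}.
Local Notation ST := ('rV[R]_n * R)%type.
Implicit Types (u g w : ST -> R) (z : ST) (x y : 'rV[R]_n).

Lemma continuous_at_sum (T : topologicalType) (I : Type) (s : seq I)
    (P : pred I) (f : I -> T -> R) (z : T) :
  (forall i, P i -> {for z, continuous (f i)}) ->
  {for z, continuous (fun w : T => \sum_(i <- s | P i) f i w)}.
Proof.
move=> cf; elim: s => [|i s IH].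
  rewrite (_ : (fun q => _) = cst 0); first exact: cst_continuous.
  by apply/funext => q; rewrite big_nil.
rewrite (_ : (fun q => _) = fun q => (if P i then f i q else 0) +
    \sum_(j <- s | P j) f j q); last first.
  by apply/funext => q; rewrite big_cons; case: ifP; rewrite // add0r.
apply: continuousD => //.
by case: (boolP (P i)) => [/cf|_]; [exact|exact: cst_continuous].
Qed.

Lemma continuous_sqdist y : continuous (sqdist y : ST -> R).
Proof.
move=> z; rewrite /sqdist.
apply: continuous_at_sum => i _.
have c : {for z, continuous (fun z : ST => z.1 ord0 i)}.
  apply: (@continuous_comp _ _ _ (@fst 'rV[R]_n R) (fun v => v ord0 i)).
    exact: cvg_fst.
  exact: coord_continuous.
have cB : {for z, continuous (fun z : ST => z.1 ord0 i - y ord0 i)}.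
  by apply: continuousB => //; exact: cst_continuous.
exact: continuousM.
Qed.

Lemma continuous_gaussian y c z : c < z.2 ->
  {for z, continuous (gaussian y c)}.
Proof.
move=> cz; have s0 : 0 < z.2 - c by rewrite subr_gt0.
have cs : {for z, continuous (fun w : ST => w.2 - c)}.
  by apply: continuousB; [exact: cvg_snd|exact: cst_continuous].
apply: (@continuous_comp _ _ _ _ expR); last exact: continuous_expR.
apply: continuousB; apply: continuousM.
- exact: cst_continuous.
- apply: (@continuous_comp _ _ _ (fun w : ST => w.2 - c) (@ln R)) => //.
  exact: continuous_ln.
- apply: continuousV; first by rewrite mulf_neq0// gt_eqF.
  by apply: continuousM => //; exact: cst_continuous.
- exact: continuous_sqdist.
Qed.

Lemma gaussian_ge0 y c z : 0 <= gaussian y c z.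
Proof. exact: expR_ge0. Qed.

Lemma sqdist_ge0 y z : 0 <= sqdist y z.
Proof. by apply: sumr_ge0 => i _; exact: sqr_ge0. Qed.

(** Powers [s ^ (n / 2)] are written as exponentials; at a square they become ordinary powers. *)
Lemma expR_ln_sqr (a : R) : 0 < a -> expR (n%:R / 2 * ln (a ^+ 2)) = a ^+ n.
Proof.
move=> a0; rewrite lnXn// -(mulr_natr (ln a)).
have -> : n%:R / 2 * (ln a * 2%:R) = n%:R * ln a by move: (ln a) => b; field.
by rewrite expRM_natl lnK.
Qed.

(** The pole lies a time [a ^ 2] earlier, the parabolic scale of the cell: the prefactor is
    [a ^ (- n)], and [sqdist y z <= n * a ^ 2] bounds the exponent. *)
Lemma gaussian_cell_ge y (a : R) z (t1 : R) : 0 < a -> z.2 = t1 ->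
  cell y a z.1 -> expR (- (n%:R / 4)) <= a ^+ n * gaussian y (t1 - a ^+ 2) z.
Proof.
move=> a0 zt yz.
rewrite -(expR_ln_sqr a0) /gaussian -expRD ler_expR zt.
have -> : t1 - (t1 - a ^+ 2) = a ^+ 2 by ring.
suff : (4 * a ^+ 2)^-1 * sqdist y z <= n%:R / 4 by lra.
have a2 : 0 < a ^+ 2 by rewrite exprn_gt0.
suff : sqdist y z <= n%:R * a ^+ 2.
  move=> H; rewrite mulrC ler_pdivrMr ?mulr_gt0//.
  by rewrite mulrA (_ : n%:R / 4 * 4 = n%:R)//; field.
rewrite -[n%:R]/(n%:R) -[X in X%:R]card_ord mulr_natl -sumr_const.
apply: ler_sum => i _; have /andP[? ?] := yz i.
by rewrite lerXn2r ?nnegrE//; lra.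
Qed.

(* The quadratic caloric term makes the comparison function dominate [u] on the
   lateral boundary, and the Gaussians do so on the bottom wherever
   [u > M / 4]; evaluating at [(x, t0)], where [u = M], forces many cells. *)
Lemma comparison_count (I : finType) (P : pred I) (y : I -> 'rV[R]_n)
    (Omega : set ST) u x (A M r a t1 t0 : R) :
  open Omega -> smooth_on Omega u ->
  (forall z, Omega z -> 1 <= heat_op u z) ->
  0 < A -> 0 < M -> 0 < r -> 0 < a -> t1 < t0 ->
  2 * n%:R * (t0 - t1) * A <= r ^+ 2 / 4 ->
  cylinder x r t1 t0 `<=` Omega ->
  (forall z, cylinder x r t1 t0 z -> u z <= A * M) ->
  u (x, t0) = M ->
  (forall z, cylinder x r t1 t0 z -> z.2 = t1 -> M / 4 < u z ->
    exists2 i, P i & cell (y i) a z.1) ->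
  expR (- (n%:R / 4)) / (2 * A) * expR (n%:R / 2 * ln (t0 - t1)) <=
    #|P|%:R * a ^+ n.
Proof.
move=> oO su Hu A0 M0 r0 a0 t10 small KO uA uM cover.
(* Chosen so that [B * sqdist x] is at least [A * M] on the lateral boundary. *)
pose B := A * M / r ^+ 2.
have B0 : 0 < B by rewrite /B divr_gt0 ?mulr_gt0 ?exprn_gt0.
have Bsmall : B * (2 * n%:R * (t0 - t1)) <= M / 4.
  rewrite (_ : _ * _ = (M / r ^+ 2) * (2 * n%:R * (t0 - t1) * A)); last first.
    by rewrite /B; ring.
  apply: le_trans (ler_wpM2l _ small) _; first by rewrite divr_ge0 ?ltW// exprn_gt0.
  by rewrite le_eqVlt; apply/orP; left; apply/eqP; field; rewrite gt_eqF.
(* By [gaussian_cell_ge], [K] times the Gaussian of a cell is at least [A * M] on that cell at time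
   [t1]. *)
pose K := A * M * expR (n%:R / 4) * a ^+ n.
have K0 : 0 < K by rewrite /K !mulr_gt0 ?expR_gt0 ?exprn_gt0.
pose c := t1 - a ^+ 2.
have ct1 : c < t1 by rewrite /c; have := exprn_gt0 2 a0; lra.
pose W z := \sum_(i | P i) K * gaussian (y i) c z.
have W0 z : 0 <= W z.
  by apply: sumr_ge0 => i _; rewrite mulr_ge0 ?gaussian_ge0// ltW.
pose w z := u z + (- B * (sqdist x z + 2 * n%:R * (z.2 - t0)) +
  (- (M / 2) + - 1 * W z)).
have cylt z : cylinder x r t1 t0 z -> c < z.2.
  by move=> [_ /andP[zt _]]; exact: lt_le_trans zt.
have hw z : cylinder x r t1 t0 z -> heat_at w z (heat_op u z).
  move=> Kz.
  have hs : heat_at (fun w : ST => sqdist x w + 2 * n%:R * (w.2 - t0)) z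
      (2 * n%:R + 2 * n%:R * - 1).
    by apply: heat_atD (heat_at_sqdist _ _) (heat_atZ _ (heat_at_time _ _)).
  have hW : heat_at W z (\sum_(i | P i) K * 0).
    by apply: heat_at_sum => i _; apply: heat_atZ; apply: heat_at_gaussian; exact: cylt.
  have := heat_atD (heat_at_smooth oO su (KO _ Kz)) (heat_atD (heat_atZ (- B) hs)
    (heat_atD (heat_at_cst (- (M / 2)) z) (heat_atZ (- 1) hW))).
  rewrite big1; last by move=> i _; rewrite mulr0.
  by rewrite !(mulr0, addr0, mulrN1, subrr).
have cwz z : cylinder x r t1 t0 z -> {for z, continuous w}.
  move=> Kz; apply: continuousD; first exact: (su [::] z (KO _ Kz)).1.
  apply: continuousD.
    apply: continuousM; first exact: cst_continuous.
    apply: continuousD; first exact: continuous_sqdist.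
    apply: continuousM; first exact: cst_continuous.
    by apply: continuousB; [exact: cvg_snd|exact: cst_continuous].
  apply: continuousD; first exact: cst_continuous.
  apply: continuousM; first exact: cst_continuous.
  apply: continuous_at_sum => i _.
  apply: continuousM; first exact: cst_continuous.
  by apply: continuous_gaussian; exact: cylt.
have cw : {within cylinder x r t1 t0, continuous w}.
  by apply: continuous_in_subspaceT => z; rewrite inE; exact: cwz.
(* The time part of the caloric polynomial costs at most [M / 4], by the hypothesis [small]. *)
have drift z : cylinder x r t1 t0 z ->
    B * (2 * n%:R * (z.2 - t0)) >= - (M / 4).
  move=> [_ /andP[zt1 zt0]].
  rewrite lerNl (le_trans _ Bsmall)// -mulrN ler_pM2l//.
  by rewrite -mulrN ler_wpM2l ?mulr_ge0//; lra.
have w0 : w (x, t0) <= 0.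
  apply: (maximum_principle cw hw).
  - by move=> z Kz; apply: lt_le_trans (Hu _ (KO _ Kz)).
  (* Bottom: either [u <= M / 4], and the drift together with [- M / 2] suffices, or one Gaussian
     alone dominates [u]. *)
  - move=> z Kz zt1; rewrite /w mulrDr !mulNr mul1r.
    have := drift _ Kz; have := mulr_ge0 (ltW B0) (sqdist_ge0 x z).
    have := W0 z; have [u4|u4] := leP (u z) (M / 4); first by lra.
    have [i Pi yi] := cover _ Kz zt1 u4.
    have : A * M <= W z; last by have := uA _ Kz; lra.
    rewrite /W (bigD1 i)//= (@le_trans _ _ (K * gaussian (y i) c z))//.
      rewrite /K -!mulrA ler_pM2l// -[leLHS]mulr1 ler_pM2l//.
      rewrite -[leLHS](expRxMexpNx_1 (n%:R / 4)) ler_pM2l ?expR_gt0//.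
      exact: gaussian_cell_ge.
    rewrite lerDl; apply: sumr_ge0 => j _.
    by rewrite mulr_ge0 ?gaussian_ge0// ltW.
  - move=> z i Kz zi; rewrite /w mulrDr !mulNr mul1r.
    have := drift _ Kz; have := W0 z; have := uA _ Kz.
    have : A * M <= B * sqdist x z; last by lra.
    rewrite /B mulrAC ler_pdivlMr ?exprn_gt0// ler_pM2l ?mulr_gt0//.
    rewrite /sqdist (bigD1 i)//= -{1}zi real_normK ?num_real// lerDl.
    by apply: sumr_ge0 => j _; exact: sqr_ge0.
  - split=> /= [i|]; first by rewrite subrr normr0 ltW.
    by rewrite lexx ltW.
have Wx : W (x, t0) <= #|P|%:R * (K * expR (- (n%:R / 2 * ln (t0 - t1)))).
  rewrite mulr_natl -sumr_const; apply: ler_sum => i _.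
  rewrite ler_pM2l// ler_expR /= mulNr.
  have : 0 <= (4 * (t0 - c))^-1 * sqdist (y i) (x, t0).
    by rewrite mulr_ge0 ?sqdist_ge0// invr_ge0; lra.
  suff : n%:R / 2 * ln (t0 - t1) <= n%:R / 2 * ln (t0 - c) by lra.
  by rewrite ler_wpM2l ?divr_ge0// ler_ln ?posrE; lra.
(* At [(x, t0)] the caloric polynomial vanishes, so [w <= 0] reads [M / 2 <= W]. *)
move: w0; rewrite /w uM {1}/sqdist big1 => [|i _]; last by rewrite /= subrr expr0n.
rewrite /= subrr mulr0 addr0 mulr0 add0r mulN1r => w0.
have {}Wx := le_trans _ Wx; have /Wx : M / 2 <= W (x, t0) by lra.
rewrite !expRN /K; set e1 := expR _; set e2 := expR _ => H.
have e10 : 0 < e1 by exact: expR_gt0.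
have e20 : 0 < e2 by exact: expR_gt0.
have ne : [&& A != 0, M != 0, e1 != 0 & e2 != 0] by rewrite !gt_eqF.
have -> : e1^-1 / (2 * A) * e2 = M / 2 * (e2 / (A * M * e1)).
  by case/and4P: ne => ? ? ? ?; field; apply/and3P.
have -> : #|P|%:R * a ^+ n =
    #|P|%:R * (A * M * e1 * a ^+ n * e2^-1) * (e2 / (A * M * e1)).
  by case/and4P: ne => ? ? ? ?; field; apply/and4P.
by rewrite ler_pM2r// divr_gt0 ?mulr_gt0.
Qed.
End density.

(** * Grids of cells and the measure of time slices *)

Section density_measure.
Context {R : realType} {n : nat}.
Local Notation ST := ('rV[R]_n * R)%type.

Lemma trivIset_grid (lo : 'I_n -> R) (a : R) N (D : set {ffun 'I_n -> 'I_N}) :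
  0 < a ->
  trivIset D (fun k => cell (\row_i (lo i + a * (k i)%:R)) a).
Proof.
move=> a0; apply/trivIsetP => k l _ _ kl.
apply/seteqP; split=> // v [vk vl]; case/eqP: kl; apply/ffunP => i; apply/val_inj.
have := vk i; have := vl i; rewrite !mxE => /andP[l1 l2] /andP[k1 k2].
apply/eqP; rewrite eqn_leq; apply/andP; split.
  by rewrite -ltnS -(ltr_nat R) -(ltr_pM2l a0) -[X in _ < a * X]natr1; lra.
by rewrite -ltnS -(ltr_nat R) -(ltr_pM2l a0) -[X in _ < a * X]natr1; lra.
Qed.

Lemma lebesgue_rV_cells (I : finType) (P : pred I) (y : I -> 'rV[R]_n) (a : R) :
  0 <= a -> trivIset [set` P] (fun i => cell (y i) a) ->
  lebesgue_rV n (\bigcup_(i in [set` P]) cell (y i) a) =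
    (#|P|%:R * a ^+ n)%:E.
Proof.
move=> a0 tP.
have E : [set` P] = [set` enum P].
  by apply/seteqP; split=> i /=; rewrite mem_enum.
have -> : #|P|%:R * a ^+ n = \sum_(i <- enum P) a ^+ n.
  by rewrite big_enum sumr_const mulr_natl.
rewrite E measure_fin_bigcup.
- rewrite -fsbig_seq ?enum_uniq// -sumEFin.
  by apply: eq_bigr => i _; exact: lebesgue_rV_cell.
- exact: finite_seq.
- by rewrite -E.
- by move=> i _; exact: measurable_cell.
Qed.

(** The displaced point may leave [K], since cells meeting the cylinder can stick out of it. Only
    space is displaced, as everything happens in one time slice. *)
Lemma compact_unif_continuous (K : set ST) (u : ST -> R) (e : R) :
  compact K -> (forall z, K z -> {for z, continuous u}) -> 0 < e ->
  exists2 d : R, 0 < d & forall z (v : 'rV[R]_n), K z ->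
    (forall i, `|v ord0 i - z.1 ord0 i| < d) -> `|u (v, z.2) - u z| < e.
Proof.
move=> cK cu e0.
pose P (d : R) (z : ST) := forall v : 'rV[R]_n,
  (forall i, `|v ord0 i - z.1 ord0 i| < d) -> `|u (v, z.2) - u z| < e.
have : \forall d \near (0 : R)^'+, K `<=` P d.
  apply: (compact_near_coveringP K).1 => // z Kz.
  have e2 : 0 < e / 2 by rewrite divr_gt0.
  have /cvgr_dist_lt/(_ _ e2)/nbhs_ballP[r /= r0 rB] := cu z Kz.
  have r2 : 0 < r / 2 by rewrite divr_gt0.
  have r2r : r / 2 <= r by rewrite ler_pdivrMr// ler_pMr// ler1n.
  exists (ball z (r / 2), [set d | d < r / 2]).
    split; first exact: nbhsx_ballx.
    exact: nbhs_right_lt.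
  move=> [w d] /= [[[_ w1] w2] dr] v vw.
  have uw : `|u z - u w| < e / 2.
    apply: rB; split; last exact: le_ball w2.
    by split=> // i j; exact: le_ball (w1 i j).
  have uv : `|u z - u (v, w.2)| < e / 2.
    apply: rB; split=> /=.
      split=> // i j; rewrite [i]ord1; have := w1 ord0 j; have := vw j.
      rewrite /ball /= => A B.
      rewrite (_ : _ - _ = (z.1 ord0 j - w.1 ord0 j) - (v ord0 j - w.1 ord0 j)).
        by apply: le_lt_trans (ler_normB _ _) _; lra.
      by ring.
    exact: le_ball w2.
  rewrite (_ : _ - _ = (u z - u w) - (u z - u (v, w.2))); last by ring.
  by apply: le_lt_trans (ler_normB _ _) _; lra.
move=> [d /= d0 dP]; exists (d / 2); first by rewrite divr_gt0.
move=> z v Kz; apply: (dP (d / 2)) => //=; last by rewrite divr_gt0.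
by rewrite sub0r normrN gtr0_norm ?divr_gt0// ltr_pdivrMr// ltr_pMr// ltr1n.
Qed.

(** The grid cells that meet [u > M / 4] are finer than the modulus of continuity, so they lie in
    [u > M / 8]; [comparison_count] bounds their total measure from below. *)
Lemma slice_measure_ge (Omega : set ST) (u : ST -> R) (x : 'rV[R]_n)
    (A M r t1 t0 : R) (F : set 'rV[R]_n) :
  open Omega -> smooth_on Omega u ->
  (forall z, Omega z -> 1 <= heat_op u z) ->
  0 < A -> 0 < M -> 0 < r -> t1 < t0 ->
  2 * n%:R * (t0 - t1) * A <= r ^+ 2 / 4 ->
  cylinder x r t1 t0 `<=` Omega ->
  (forall z, cylinder x r t1 t0 z -> u z <= A * M) ->
  u (x, t0) = M -> measurable F ->
  (forall v : 'rV[R]_n, (forall i, `|v ord0 i - x ord0 i| <= 2 * r) ->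
    M / 8 < u (v, t1) -> F v) ->
  ((expR (- (n%:R / 4)) / (2 * A) * expR (n%:R / 2 * ln (t0 - t1)))%:E <=
    lebesgue_rV n F)%E.
Proof.
move=> oO su Hu A0 M0 r0 t10 small KO uA uM mF uF.
have [d d0 du] : exists2 d : R, 0 < d &
    forall z (v : 'rV[R]_n), cylinder x r t1 t0 z ->
    (forall i, `|v ord0 i - z.1 ord0 i| < d) -> `|u (v, z.2) - u z| < M / 8.
  apply: compact_unif_continuous; first exact: compact_cylinder.
    by move=> z Kz; exact: (su [::] z (KO _ Kz)).1.
  by rewrite divr_gt0.
(* The grid has [N + 1] cells per side of the cube of radius [2 * r]. Taking [a < r] keeps every
   cell that meets the cube of radius [r] inside it. *)
pose N := Num.truncn (4 * r / Num.min d r).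
pose a := 4 * r / N.+1%:R.
have m0 : 0 < Num.min d r by rewrite lt_min d0 r0.
have a0 : 0 < a by rewrite /a divr_gt0// mulr_gt0.
have /andP[ad ar] : (a < d) && (a < r).
  rewrite -lt_min /a ltr_pdivrMr// [ltRHS]mulrC -ltr_pdivrMr//.
  exact: truncnS_gt.
pose y (k : {ffun 'I_n -> 'I_N.+1}) : 'rV[R]_n :=
  \row_i (x ord0 i - 2 * r + a * (k i)%:R).
pose P : pred {ffun 'I_n -> 'I_N.+1} := fun k =>
  `[< exists z, [/\ cylinder x r t1 t0 z, z.2 = t1, M / 4 < u z &
        cell (y k) a z.1] >].
have cover z : cylinder x r t1 t0 z -> z.2 = t1 -> M / 4 < u z ->
    exists2 k, P k & cell (y k) a z.1.
  move=> Kz zt uz.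
  (* The cell containing [z] is found by truncating the rescaled coordinates. *)
  pose k : {ffun 'I_n -> 'I_N.+1} :=
    [ffun i => inord (Num.truncn ((z.1 ord0 i - (x ord0 i - 2 * r)) / a))].
  suff yz : cell (y k) a z.1 by exists k => //; apply/asboolP; exists z.
  move=> i; have [/(_ i) + _] := Kz; rewrite ler_norml => /andP[z1 z2].
  set q := (z.1 ord0 i - (x ord0 i - 2 * r)) / a.
  have q0 : 0 <= q by rewrite divr_ge0 ?ltW//; lra.
  have qN : (Num.truncn q < N.+1)%N.
    rewrite truncn_lt_nat// /q ltr_pdivrMr//.
    by rewrite /a [ltRHS]mulrC divfK ?pnatr_eq0//; lra.
  rewrite !mxE ffunE inordK// -/q.
  have /andP[] := truncn_itv q0.
  rewrite -natr1 -(ler_pM2l a0) -(ltr_pM2l a0).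
  have -> : a * q = z.1 ord0 i - (x ord0 i - 2 * r).
    by rewrite /q mulrC divfK ?gt_eqF.
  by rewrite mulrDr mulr1 => q1 q2; apply/andP; split; lra.
have := comparison_count oO su Hu A0 M0 r0 a0 t10 small KO uA uM cover.
move=> H; apply: (@le_trans _ _ (#|P|%:R * a ^+ n)%:E); first by rewrite lee_fin.
rewrite -(@lebesgue_rV_cells _ P y a (ltW a0)); last first.
  exact: (@trivIset_grid (fun i => x ord0 i - 2 * r)).
apply: (@le_measure _ _ _ (lebesgue_rV n)); rewrite ?inE//.
  by apply: fin_bigcup_measurable => // k _; exact: measurable_cell.
move=> v [k /= /asboolP[z [Kz zt uz yz]] yv].
have vz i : `|v ord0 i - z.1 ord0 i| < a.
  have /andP[? ?] := yv i; have /andP[? ?] := yz i.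
  by rewrite ltr_norml; apply/andP; split; lra.
apply: uF => [i|].
  have := vz i; have [/(_ i) + _] := Kz.
  by rewrite !ler_norml ltr_norml => /andP[? ?] /andP[? ?]; apply/andP; split; lra.
have := du z v Kz (fun i => lt_trans (vz i) ad); rewrite zt ltr_norml.
by move=> /andP[? ?]; lra.
Qed.

End density_measure.

(** * Space-time measure of superlevel sets *)

Section lower_bounds.
Context {R : realType} {n : nat}.
Local Notation ST := ('rV[R]_n * R)%type.
Local Notation mu := (lebesgue_rV n \x @lebesgue_measure R)%E.

Lemma measurable_cylinder (x : 'rV[R]_n) (r t1 t0 : R) :
  measurable (cylinder x r t1 t0).
Proof.
rewrite cylinderE.
by apply: measurableX; [exact: measurable_coords|exact: measurable_itv].
Qed.

Lemma norm_le_cylinder (x : 'rV[R]_n) (t r : R) (z : ST) : 0 <= r ->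
  (`|z - (x, t)| <= r) <-> cylinder x r (t - r) (t + r) z.
Proof.
move=> r0; case: z => v s.
rewrite prod_normE ge_max /=.
split.
  move=> /andP[vx st]; split=> /= [i|]; last by rewrite -ler_distl.
  apply: le_trans vx; rewrite [leRHS]/Num.norm /= mx_normrE.
  apply/bigmax_geP; right => /=; exists (ord0, i) => //=.
  by rewrite !mxE.
move=> [vx st]; rewrite ler_distl st andbT [leLHS]/Num.norm /= mx_normrE.
apply/bigmax_leP; split=> //= -[i j] _ /=; rewrite [i]ord1 !mxE; exact: vx.
Qed.

(** With [s = th * r ^ 2], each slice at a time in [[t0 - 2 * s, t0 - s]] carries measure of order
    [s ^ (n / 2)], that is [r ^ n]; integrating over a time of length [s] yields [r ^ (n + 2)]. *)
Lemma superlevel_measure_ge (A : R) : 1 <= A -> exists2 k : R, 0 < k &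
  forall (Omega : set ST) (u : ST -> R) (x : 'rV[R]_n) (t0 M r : R),
  open Omega -> smooth_on Omega u ->
  (forall z, Omega z -> 1 <= heat_op u z) ->
  0 < r -> r <= 1 -> 0 < M ->
  cylinder x r (t0 - r) (t0 + r) `<=` Omega ->
  (forall z, cylinder x r (t0 - r) (t0 + r) z -> u z <= A * M) ->
  u (x, t0) = M ->
  exists E : set ST, [/\ measurable E,
    E `<=` cylinder x r (t0 - r) (t0 + r), (forall z, E z -> M / 8 < u z) &
    ((k * r ^+ n.+2)%:E <= mu E)%E].
Proof.
move=> A1; have A0 : 0 < A by exact: lt_le_trans A1.
(* For [t0 - t <= 2 * s], the smallness condition of [slice_measure_ge] at radius [r / 2] amounts to
   [64 * n * A * th <= 1]. *)
pose th := (64 * n.+1%:R * A)^-1.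
have th0 : 0 < th by rewrite invr_gt0 !mulr_gt0.
have thE : 64 * n.+1%:R * A * th = 1 by rewrite mulfV// gt_eqF// !mulr_gt0.
have th1 : th <= 1 / 64.
  rewrite /th div1r lef_pV2 ?posrE ?mulr_gt0// -mulrA ler_peMr//.
  by rewrite -[leLHS]mulr1 ler_pM// ler1n.
pose k0 := expR (- (n%:R / 4)) / (2 * A) * expR (n%:R / 2 * ln th).
have k00 : 0 < k0 by rewrite /k0 !mulr_gt0 ?expR_gt0// invr_gt0 mulr_gt0.
exists (k0 * th); first by rewrite mulr_gt0.
move=> Omega u x t0 M r oO su Hu r0 r1 M0 KO uA uM.
have r20 : 0 < r ^+ 2 by rewrite exprn_gt0.
have rr : r ^+ 2 <= r by rewrite expr2 ger_pMl.
set s := th * r ^+ 2.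
have s0 : 0 < s by rewrite /s mulr_gt0.
have sr : s <= r / 64.
  by rewrite /s (le_trans (ler_wpM2r (ltW r20) th1))//; lra.
pose E := cylinder x r (t0 - r) (t0 + r) `&` (Omega `&` [set z | M / 8 < u z]).
have mE : measurable E.
  apply: measurableI; first exact: measurable_cylinder.
  apply: measurable_open; rewrite openE => z [Oz yz].
  apply: filterI; first exact: open_nbhs_nbhs.
  by have /cvgr_gt/(_ _ yz) := (su [::] z Oz).1.
exists E; split=> //; [by move=> z []|by move=> z [_ []]|].
have -> : k0 * th * r ^+ n.+2 = k0 * r ^+ n * ((t0 - s) - (t0 - 2 * s)).
  by rewrite /s !exprS; ring.
apply: measure_slices_ge => //; first by lra.
  by rewrite mulr_ge0 ?exprn_ge0// ltW.
move=> t /andP[t1 t2].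
have sub z : cylinder x (r / 2) t t0 z -> cylinder x r (t0 - r) (t0 + r) z.
  move=> [zx /andP[? ?]]; split=> [i|]; first by have := zx i; lra.
  by apply/andP; split; lra.
(* Radius [r / 2], because the slice lemma finds its set in the cube of twice the radius. *)
apply: le_trans (@slice_measure_ge _ _ Omega u x A M (r / 2) t t0
    (ysection E t) oO su Hu A0 M0 _ _ _ _ _ uM _ _).
- rewrite lee_fin /k0 -[leLHS]mulrA -(@expR_ln_sqr R n r r0) -expRD -mulrDr.
  rewrite -lnM ?posrE// -/s ler_pM2l ?divr_gt0 ?expR_gt0 ?mulr_gt0// ler_expR.
  by rewrite ler_wpM2l ?divr_ge0// ler_ln ?posrE//; lra.
- by rewrite divr_gt0.
- by lra.
- apply: (@le_trans _ _ (2 * n%:R * (2 * s) * A)).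
    by rewrite ler_pM2r// ler_wpM2l ?mulr_ge0//; lra.
  rewrite (_ : _ * A = (64 * n%:R * A * th) * (r ^+ 2 / 16)); last first.
    by rewrite /s; field.
  rewrite (_ : (r / 2) ^+ 2 / 4 = 1 * (r ^+ 2 / 16)); last by field.
  rewrite ler_pM2r ?divr_gt0// -[leRHS]thE.
  apply: ler_wpM2r; first exact: ltW.
  apply: ler_wpM2r; first exact: ltW.
  by rewrite ler_wpM2l// ler_nat.
- by move=> z /sub/KO.
- by move=> z /sub/uA.
- exact: measurable_ysection.
- move=> v vx uv; rewrite /ysection /= inE.
  have Kv : cylinder x r (t0 - r) (t0 + r) (v, t).
    split=> /= [i|]; first by have := vx i; lra.
    by apply/andP; split; lra.
  by split=> //; split=> //; exact: KO.
Qed.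

End lower_bounds.

(** * Lower bounds for the integral *)

Section final_bounds.
Context {R : realType} {n : nat}.
Local Notation ST := ('rV[R]_n * R)%type.
Local Notation mu := (lebesgue_rV n \x @lebesgue_measure R)%E.

(** Adding to [u - h] the barrier with factor [a = 1 / (n + 1)] keeps the heat operator positive and
    the boundary values nonpositive. On the smaller cylinder the barrier is at least [2 * h], so
    [u <= h - 2 * h]. *)
Lemma negative_below (Omega : set ST) (u : ST -> R) (x : 'rV[R]_n)
    (t r : R) : open Omega -> smooth_on Omega u ->
  (forall z, Omega z -> 1 <= heat_op u z) -> 0 < r -> r <= 1 / 2 ->
  cylinder x r (t - r) t `<=` Omega ->
  (forall z, cylinder x r (t - r) t z -> u z <= r ^+ 3 / (8 * n.+1%:R)) ->
  forall z, cylinder x (r / (2 * n.+1%:R)) (t - r / 2) t z ->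
    u z <= - (r ^+ 3 / (8 * n.+1%:R)).
Proof.
move=> oO su Hu r0 r12 KO ue z Kz.
set b := r / (2 * n.+1%:R) in Kz.
set h := r ^+ 3 / (8 * n.+1%:R) in ue *.
pose a : R := n.+1%:R^-1.
have a0 : 0 < a by rewrite invr_gt0.
have aE : a * n.+1%:R = 1 by rewrite mulVf.
have a1 : a <= 1 by rewrite invf_le1// ler1n.
have aE' : a * n%:R + a = 1 by move: aE; rewrite -natr1 mulrDr mulr1.
have an0 : 0 <= a * n%:R by rewrite mulr_ge0// ltW.
have r20 : 0 < r ^+ 2 by rewrite exprn_gt0.
have hE : h = a * r ^+ 3 / 8 by rewrite /h invfM -/a; ring.
pose w z := u z + (- h + a * ((z.2 - (t - r)) * (r ^+ 2 - sqdist x z))).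
pose L z := heat_op u z +
  (0 + a * - (2 * n%:R * (z.2 - (t - r)) + (r ^+ 2 - sqdist x z))).
have hw z' : cylinder x r (t - r) t z' -> heat_at w z' (L z').
  move=> Kz'; apply: heat_atD; first exact: heat_at_smooth oO su (KO _ Kz').
  by apply: heat_atD (heat_at_cst _ _) (heat_atZ _ (heat_at_barrier _ _ _ _)).
have cw : {within cylinder x r (t - r) t, continuous w}.
  have cwz z' : cylinder x r (t - r) t z' -> {for z', continuous w}.
    move=> Kz'; apply: continuousD; first exact: (su [::] z' (KO _ Kz')).1.
    apply: continuousD; first exact: cst_continuous.
    apply: continuousM; first exact: cst_continuous.
    apply: continuousM.
      by apply: continuousB; [exact: cvg_snd|exact: cst_continuous].
    by apply: continuousB; [exact: cst_continuous|exact: continuous_sqdist].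
  by apply: continuous_in_subspaceT => z'; rewrite inE; exact: cwz.
have br : b <= r.
  have n1 : 1 <= n.+1%:R :> R by rewrite ler1n.
  by rewrite /b ler_pdivrMr ?mulr_gt0//; nra.
have Kz' : cylinder x r (t - r) t z.
  have [zx /andP[zt1 zt2]] := Kz; split=> [i|].
    exact: le_trans (zx i) br.
  by apply/andP; split=> //; lra.
have : w z <= 0.
  apply: (maximum_principle cw hw) => // {z Kz Kz'}.
  (* As [r <= 1 / 2], the barrier lowers the heat operator by at most [a * n + a / 4], which is less
     than [a * n + a = 1]. *)
  - move=> z Kz; have := Hu _ (KO _ Kz); have [_ /andP[zt1 zt2]] := Kz.
    have sq0 := sqdist_ge0 x z.
    rewrite /L add0r => H.
    have H1 : a * n%:R * (2 * (z.2 - (t - r))) <= a * n%:R * (2 * r).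
      by rewrite ler_wpM2l//; lra.
    have H2 : a * n%:R * (2 * r) <= a * n%:R * 1 by rewrite ler_wpM2l//; lra.
    have H3 : a * (r ^+ 2 - sqdist x z) <= a * (1 / 4).
      by rewrite ler_pM2l//; nra.
    have -> : a * - (2 * n%:R * (z.2 - (t - r)) + (r ^+ 2 - sqdist x z)) =
      - (a * n%:R * (2 * (z.2 - (t - r))) + a * (r ^+ 2 - sqdist x z)) by ring.
    by lra.
  - move=> z Kz zt; rewrite /w zt subrr mul0r mulr0 addr0 subr_le0; exact: ue.
  - move=> z i Kz zi; rewrite /w addrA.
    have : a * ((z.2 - (t - r)) * (r ^+ 2 - sqdist x z)) <= 0.
      have [_ /andP[zt1 _]] := Kz.
      rewrite pmulr_rle0// mulr_ge0_le0 ?subr_ge0// subr_le0.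
      rewrite /sqdist (bigD1 i)//= -{1}zi real_normK ?num_real// lerDl.
      by apply: sumr_ge0 => j _; exact: sqr_ge0.
    by have := ue _ Kz; lra.
rewrite /w.
have sqb : sqdist x z <= r ^+ 2 / 2.
  apply: (@le_trans _ _ (n%:R * b ^+ 2)).
    rewrite -[X in X%:R]card_ord mulr_natl -sumr_const.
    apply: ler_sum => i _; rewrite -real_normK ?num_real//.
    by rewrite lerXn2r ?nnegrE// ?(Kz.1 i)//; apply: le_trans (Kz.1 i).
  rewrite /b expr_div_n mulrA ler_pdivrMr ?exprn_gt0 ?mulr_gt0//.
  rewrite [leLHS]mulrC -[leRHS]mulrA ler_pM2l//.
  have nn : n%:R <= n.+1%:R :> R by rewrite ler_nat.
  have n1 : 1 <= n.+1%:R :> R by rewrite ler1n.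
  nra.
have [_ /andP[zt1 _]] := Kz.
have : a * ((r / 2) * (r ^+ 2 / 2)) <=
    a * ((z.2 - (t - r)) * (r ^+ 2 - sqdist x z)).
  by rewrite ler_pM2l// ler_pM//; lra.
have -> : a * ((r / 2) * (r ^+ 2 / 2)) = 2 * h by rewrite hE; field.
by lra.
Qed.

(* Maximizing [(r - |z - (x, t)|) ^ g * u z] yields a point near which [u] is at
   most [2 ^ g] times its value there, as [superlevel_measure_ge] requires. *)
Lemma Lp_ge_superlevel (p r h : R) (g : nat) : 0 < p -> n.+2%:R <= g%:R * p ->
  0 < r -> r <= 1 -> 0 < h -> exists2 c : R, 0 < c &
  forall (Omega : set ST) (u : ST -> R) (x : 'rV[R]_n) (t : R),
  open Omega -> smooth_on Omega u ->
  (forall z, Omega z -> 1 <= heat_op u z) ->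
  cylinder x r (t - r) (t + r) `<=` Omega ->
  (exists2 z, `|z - (x, t)| <= r / 2 & h < u z) ->
  (c%:E <= \int[mu]_(z in Omega) (`|u z| `^ p)%:E)%E.
Proof.
move=> p0 gp r0 r1 h0.
have A1 : 1 <= (2 : R) ^+ g by rewrite exprn_ege1// ler1n.
have [k k0 kP] := @superlevel_measure_ge R n _ A1.
pose c := k / 2 ^+ n.+2 * (h * (r / 2) ^+ g / 8) `^ p.
have r2 : 0 < r / 2 by rewrite divr_gt0.
exists c.
  by rewrite /c !mulr_gt0// ?invr_gt0 ?exprn_gt0// powR_gt0// !mulr_gt0// exprn_gt0.
move=> Omega u x t oO su Hu KO [z0 z0r uz0].
pose D (z : ST) := r - `|z - (x, t)|.
set K := cylinder x r (t - r) (t + r) in KO.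
have KD z : K z <-> 0 <= D z.
  by rewrite subr_ge0; split=> /norm_le_cylinder; apply; exact: ltW.
pose f (z : ST) := D z ^+ g * u z.
have cf : {within K, continuous f}.
  have cfz z : K z -> {for z, continuous f}.
    move=> Kz; apply: continuousM; last exact: (su [::] z (KO _ Kz)).1.
    have cD : {for z, continuous D}.
      apply: continuousB; first exact: cst_continuous.
      apply: cvg_norm; apply: (@continuousB _ _ _ id) => //.
      exact: cst_continuous.
    apply: (@continuous_comp _ _ _ D (fun y : R => y ^+ g) z cD).
    exact: exprn_continuous.
  by apply: continuous_in_subspaceT => z; rewrite inE; exact: cfz.
have Kz0 : K z0 by apply/KD; rewrite /D; lra.
have [z1 Kz1 fmax] := compact_EVT_max (ex_intro _ z0 Kz0)
  (@compact_cylinder R n x r (t - r) (t + r)) cf.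
rewrite inE -/K in Kz1.
have {}fmax z : K z -> f z <= f z1 by move=> Kz; apply: fmax; rewrite inE.
set M := u z1; set d := D z1.
have d0' : 0 <= d by apply/KD.
have fz0 : h * (r / 2) ^+ g <= f z0.
  rewrite /f [leLHS]mulrC; apply: ler_pM.
  - by rewrite exprn_ge0// ltW.
  - exact: ltW.
  - by apply: lerXn2r; rewrite ?nnegrE /D; lra.
  - exact: ltW.
have fz1 : h * (r / 2) ^+ g <= d ^+ g * M by exact: le_trans (fmax _ Kz0).
have hr0 : 0 < h * (r / 2) ^+ g by rewrite mulr_gt0// exprn_gt0.
have dM0 : 0 < d ^+ g * M by exact: lt_le_trans fz1.
(* A positive exponent makes the weight vanish where [D = 0], so the maximum point has [d > 0]. *)
have g0 : (0 < g)%N.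
  by rewrite lt0n; apply/eqP => g0; move: gp; rewrite g0 mul0r leNgt ltr0n.
have d0 : 0 < d.
  rewrite lt_neqAle d0' andbT; apply/eqP => d00.
  by move: dM0; rewrite -d00 expr0n gtn_eqF// mul0r ltxx.
have M0 : 0 < M by move: dM0; rewrite pmulr_rgt0 ?exprn_gt0.
have d1 : d <= 1 by rewrite /d /D; have := normr_ge0 (z1 - (x, t)); lra.
have d2 : 0 < d / 2 by rewrite divr_gt0.
(* Halving [d] keeps the weight at least [(d / 2) ^ g] on this cylinder, which yields the ratio
   [A = 2 ^ g]. *)
pose Kd := cylinder z1.1 (d / 2) (z1.2 - d / 2) (z1.2 + d / 2).
have KdD z : Kd z -> d / 2 <= D z.
  move=> /norm_le_cylinder -/(_ (ltW d2)); rewrite -surjective_pairing => zz1.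
  have := ler_normD (z - z1) (z1 - (x, t)).
  by rewrite addrA subrK; move: zz1; rewrite /d /D; lra.
have KdK z : Kd z -> K z.
  by move=> /KdD dz; apply/KD; apply: le_trans dz; exact: ltW.
have [||||E [mE EK uE Ek]] := kP Omega u z1.1 z1.2 M (d / 2) oO su Hu d2 _ M0.
- by lra.
- by move=> z /KdK/KO.
- move=> z Kdz; have Dz := KdD _ Kdz.
  have [u0|u0] := leP (u z) 0.
    by apply: (le_trans u0); rewrite mulr_ge0 ?exprn_ge0// ltW.
  rewrite -(ler_pM2l (_ : 0 < (d / 2) ^+ g)) ?exprn_gt0//.
  apply: (@le_trans _ _ (f z)).
    by rewrite /f ler_pM2r//; apply: lerXn2r; rewrite ?nnegrE; lra.
  apply: le_trans (fmax _ (KdK _ Kdz)) _.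
  by rewrite mulrA -exprMn divfK// /f.
- by rewrite -surjective_pairing.
have EO : E `<=` Omega by move=> z /EK/KdK/KO.
have M8 : 0 <= M / 8 by rewrite divr_ge0// ltW.
have := @le_Lp_integral R n Omega u p (M / 8) E oO
  (fun z Oz => (su [::] z Oz).1) mE EO p0 M8.
move=> H; apply: le_trans (H _); last first.
  by move=> z /uE uz; apply: le_trans (ler_norm _); exact: ltW.
apply: (@le_trans _ _ (((M / 8) `^ p)%:E * (k * (d / 2) ^+ n.+2)%:E)%E); last first.
  by apply: lee_wpmul2l => //; rewrite lee_fin powR_ge0.
rewrite -EFinM lee_fin /c [X in _ * (k * X)]expr_div_n.
have -> : (M / 8) `^ p * (k * (d ^+ n.+2 / 2 ^+ n.+2)) =
    k / 2 ^+ n.+2 * (d ^+ n.+2 * (M / 8) `^ p) by ring.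
rewrite ler_pM2l ?divr_gt0 ?exprn_gt0//.
(* Since [d <= 1] and [n + 2 <= g * p], [d ^ (n + 2)] is at least [d ^ (g * p)]. The unknown [d] and
   [M] then enter only through [d ^ g * M], which is bounded below. *)
apply: (@le_trans _ _ ((d ^+ g * (M / 8)) `^ p)).
  apply: ge0_ler_powR; rewrite ?nnegrE.
  - exact: ltW.
  - by rewrite ltW// divr_gt0.
  - by rewrite mulr_ge0// exprn_ge0.
  - by rewrite mulrA ler_pM2r.
rewrite powRM ?exprn_ge0// ler_wpM2r ?powR_ge0//.
rewrite -(@powR_mulrn _ d g)// -powRrM -(@powR_mulrn _ d n.+2)//.
by apply: ger_powR => //; rewrite d0.
Qed.

End final_bounds.

(** * Combination of the two cases *)

Unset Implicit Arguments.

Theorem theorem1p4 (R : realType) (n : nat) (Omega : set ('rV[R]_n * R))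
    (Omega_neq0 : Omega !=set0) (Omega_open : open Omega)
    (Omega_bounded : bounded_set Omega) (p : R) (p_gt0 : 0 < p) (p_lt1 : p < 1) :
  exists2 c : R, 0 < c &
    forall u : 'rV[R]_n * R -> R,
      smooth_on Omega u ->
      (forall z, Omega z -> 1 <= heat_op u z) ->
      (c%:E <= Lp_quasinorm Omega p u)%E.
Proof.
have [[x t] Oxt] := Omega_neq0.
have [e /= e0 eO] := (nbhs_ballP _ _).1 (open_nbhs_nbhs (conj Omega_open Oxt)).
(* Half of [e] puts the closed cylinder inside the open ball; the cap at [1] makes [s = r / 2] at
   most [1 / 2], as [negative_below] requires. *)
pose r := Num.min 1 (e / 2).
have e2 : 0 < e / 2 by rewrite divr_gt0.
have r0 : 0 < r by rewrite lt_min ltr01 e2.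
have r1 : r <= 1 by rewrite ge_min lexx.
have re : r < e.
  by apply: (@le_lt_trans _ _ (e / 2)); rewrite ?ge_min ?lexx ?orbT//; lra.
have KO : cylinder x r (t - r) (t + r) `<=` Omega.
  move=> z Kz; apply: eO; rewrite prod_norm_ball /= /ball_ /= distrC.
  by apply: le_lt_trans re; apply/norm_le_cylinder => //; exact: ltW.
set s := r / 2.
have s0 : 0 < s by rewrite divr_gt0.
pose h := s ^+ 3 / (8 * n.+1%:R).
have h0 : 0 < h by rewrite divr_gt0 ?exprn_gt0// mulr_gt0.
pose b := s / (2 * n.+1%:R).
have b0 : 0 < b by rewrite divr_gt0// mulr_gt0.
pose g := (Num.truncn (n.+2%:R / p)).+1.
have gp : n.+2%:R <= g%:R * p.
  by rewrite -ler_pdivrMr// ltW//; exact: truncnS_gt.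
have [c c0 cP] := @Lp_ge_superlevel R n p r h g p_gt0 gp r0 r1 h0.
(* The bound for the second case: [|u| >= h] on a set of measure [b ^ n * (s / 2)]. *)
pose c' := h `^ p * (b ^+ n * (s / 2)).
have c'0 : 0 < c'.
  apply: mulr_gt0; first exact: powR_gt0.
  by apply: mulr_gt0; [exact: exprn_gt0|exact: divr_gt0].
exists (Num.min c c' `^ p^-1); first by rewrite powR_gt0// lt_min c0 c'0.
move=> u su Hu.
suff H : ((Num.min c c')%:E <=
    \int[lebesgue_rV n \x @lebesgue_measure R]_(z in Omega) (`|u z| `^ p)%:E)%E.
  rewrite /Lp_quasinorm -poweR_EFin.
  have m0 : (0 <= (Num.min c c')%:E)%E by rewrite lee_fin ltW// lt_min c0 c'0.
  apply: gt0_ler_poweR => //; rewrite ?invr_ge0 ?(ltW p_gt0)// in_itv /= leey andbT//.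
  exact: le_trans H.
have [hu|hu] := pselect (exists2 z, `|z - (x, t)| <= s & h < u z).
  apply: le_trans (cP Omega u x t Omega_open su Hu KO hu).
  by rewrite lee_fin ge_min lexx.
have Ks : cylinder x s (t - s) t `<=` cylinder x r (t - r) (t + r).
  move=> z [zx /andP[zt1 zt2]]; split=> [i|]; last by apply/andP; split; rewrite /s in zt1; lra.
  by apply: le_trans (zx i) _; rewrite /s; lra.
have neg := @negative_below R n Omega u x t s Omega_open su Hu s0.
have {}neg : forall z, cylinder x b (t - s / 2) t z -> u z <= - h.
  apply: neg; first by rewrite /s; lra.
    by move=> z /Ks/KO.
  move=> z [zx /andP[zt1 zt2]]; rewrite leNgt; apply/negP => hz; apply: hu.
  exists z => //; apply/norm_le_cylinder; first exact: ltW.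
  by split=> //; apply/andP; split=> //; lra.
pose J := `[t - s / 2, t]%classic.
(* One corner of the cylinder where [u <= - h], taken as a cell because its measure is known. *)
pose E := cell x b `*` J.
have EK : E `<=` cylinder x b (t - s / 2) t.
  move=> z [zx]; rewrite /J /= in_itv /= => zt; split=> // i.
  by have /andP[? ?] := zx i; rewrite ger0_norm; lra.
have bs : b <= s.
  have n1 : 1 <= n.+1%:R :> R by rewrite ler1n.
  by rewrite /b ler_pdivrMr ?mulr_gt0//; nra.
have EO : E `<=` Omega.
  move=> z /EK [zx /andP[zt1 zt2]]; apply/KO/Ks; split=> [i|].
    exact: le_trans (zx i) bs.
  by apply/andP; split=> //; lra.
have mE : measurable E.
  by apply: measurableX; [exact: measurable_cell|exact: measurable_itv].
have := @le_Lp_integral R n Omega u p h E Omega_open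
  (fun z Oz => (su [::] z Oz).1) mE EO p_gt0 (ltW h0).
move=> H; apply: le_trans (H _); last first.
  move=> z /EK/neg uz; have u0 : u z <= 0 by lra.
  by rewrite (ler0_norm u0) lerNr.
have -> : (lebesgue_rV n \x @lebesgue_measure R)%E E = (b ^+ n * (s / 2))%:E.
  have mJ : measurable J by exact: measurable_itv.
  transitivity (lebesgue_rV n (cell x b) * @lebesgue_measure R J)%E.
    exact: (@product_measure1E _ _ _ _ R (lebesgue_rV n) (@lebesgue_measure R)
      _ _ (measurable_cell x b) mJ).
  rewrite (lebesgue_rV_cell _ (ltW b0)) lebesgue_measure_itv /= lte_fin.
  rewrite ifT; last by lra.
  by rewrite -EFinD -EFinM; congr (_ * _)%:E; ring.
by rewrite -EFinM lee_fin ge_min lexx orbT.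
Qed.
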